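(* Let $M$ be a nonempty subset of a normed space $X$ and let $S,T:M\to M$. Let $\phi:[0,\infty)\to[0,\infty)$ be Lebesgue measurable, Lebesgue summable on each compact subset of $[0,\infty)$, with $\int_0^\epsilon\phi(t)\,dt>0$ for all $\epsilon>0$. Let $\gamma:(0,\infty)\to(0,\infty)$ be nondecreasing with $\gamma(t)<t$ for all $t>0$, with the convention $\gamma(0)=0$. Suppose that: (i) $(S,T)$ is a generalized $\mathcal{JH}$-operator pair with order $n_0$ for some $n_0\in\mathbb{N}$; (ii) for all $x,y\in M$, $$\psi\Big(\int_0^{\|Tx-Ty\|}\phi(t)\,dt\Big)\le F\Big(\psi\Big(\int_0^{\gamma(m_2(x,y))}\phi(t)\,dt\Big),\ \varphi\Big(\int_0^{\gamma(m_2(x,y))}\phi(t)\,dt\Big)\Big),$$ where $$m_2(x,y)=\max\Big\{\|Sx-Sy\|,\|Sx-Tx\|,\|Sy-Ty\|,\tfrac12\big[\|Sx-Ty\|+\|Sy-Tx\|\big]\Big\},$$ and $\psi\in\Psi$, $\varphi\in\Phi_u$, $F\in\mathcal{C}$ are such that $(\psi,\varphi,F)$ is monotone. Then $\mathrm{Fix}(S)\cap\mathrm{Fix}(T)\ne\emptyset$.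
   Context: $\mathrm{Fix}(T)$ is the set of fixed points of $T$. $\delta(A)$ is the diameter of a set $A$. For self-maps $S,T$ of $M$, $PC(S,T)=\{w\in M:\ w=Sx=Tx\text{ for some }x\in M\}$ is the set of points of coincidence. $(S,T)$ is a generalized $\mathcal{JH}$-operator pair with order $n\in\mathbb{N}$ ($n\ge 1$) if there exist $x\in M$ and $w=Sx=Tx\in PC(S,T)$ with $\|w-x\|\le(\delta(PC(S,T)))^n$. $\Psi$ is the set of altering distance functions: continuous non-decreasing $\psi:[0,\infty)\to[0,\infty)$ with $\psi(t)=0$ iff $t=0$. $\Phi_u$ is the set of ultra altering distance functions: continuous nondecreasing $\varphi:[0,\infty)\to[0,\infty)$ with $\varphi(t)>0$ for $t>0$ (and $\varphi(0)\ge0$). $\mathcal{C}$ is the set of $C$-class functions: continuous $F:[0,\infty)^2\to\mathbb{R}$ such that for all $s,t\ge0$: $F(s,t)\le s$, and $F(s,t)=s$ implies $s=0$ or $t=0$. The triple $(\psi,\varphi,F)$ is monotone if for all $x,y\in[0,\infty)$, $x\le y$ implies $F(\psi(x),\varphi(x))\le F(\psi(y),\varphi(y))$. *)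

(* Defs.v *)
From mathcomp Require Import all_boot all_order all_algebra.
From mathcomp Require Import all_classical all_reals all_analysis.
Import Order.TTheory GRing.Theory Num.Theory.
Import numFieldNormedType.Exports.

Set Implicit Arguments.
Unset Strict Implicit.
Unset Printing Implicit Defensive.

Local Open Scope classical_set_scope.
Local Open Scope ring_scope.

Section self_maps.
Context {R : realType} {X : normedModType R}.
Implicit Types (M A : set X) (S T : X -> X).

Definition Fix M T : set X := [set x | M x /\ T x = x].

Definition PC M S T : set X := [set w | M w /\ exists2 x, M x & w = S x /\ w = T x].

(* Extended real: +oo for an unbounded set; the value -oo at set0 plays no role,
   since only nonempty sets are measured below. *)
Definition diameter A : \bar R :=
  ereal_sup [set `|x - y|%:E | x in A & y in A].

(* For 0 < n one has (+oo ^+ n = +oo)%E, so that the inequality always holds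
   when [PC M S T] is unbounded. *)
Definition generalized_JH_operator_pair M S T (n : nat) : Prop :=
  (0 < n)%N /\
  exists x w, [/\ M x, PC M S T w, w = S x, w = T x &
    (`|w - x|%:E <= diameter (PC M S T) ^+ n)%E].

Definition m2 S T (x y : X) : R :=
  Num.max `|S x - S y|
    (Num.max `|S x - T x|
      (Num.max `|S y - T y|
        (2^-1 * (`|S x - T y| + `|S y - T x|)))).

End self_maps.

(* Functions with domain [0, +oo[, ]0, +oo[ or [0, +oo[ ^ 2 are represented by
   total functions that are constrained on that domain only. *)
Section control_functions.
Context {R : realType}.
Local Notation Rplus := (`[0, +oo[%classic : set R).

Definition nondecreasing_on_Rplus (f : R -> R) : Prop :=
  forall x y : R, 0 <= x -> x <= y -> f x <= f y.

Definition altering_distance (psi : R -> R) : Prop :=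
  [/\ forall t : R, 0 <= t -> 0 <= psi t,
      {within Rplus, continuous psi},
      nondecreasing_on_Rplus psi &
      forall t : R, 0 <= t -> (psi t = 0 <-> t = 0)].

Definition ultra_altering_distance (vphi : R -> R) : Prop :=
  [/\ forall t : R, 0 <= t -> 0 <= vphi t,
      {within Rplus, continuous vphi},
      nondecreasing_on_Rplus vphi &
      forall t : R, 0 < t -> 0 < vphi t].

Definition C_class (F : R * R -> R) : Prop :=
  [/\ {within Rplus `*` Rplus, continuous F},
      forall s t : R, 0 <= s -> 0 <= t -> F (s, t) <= s &
      forall s t : R, 0 <= s -> 0 <= t -> F (s, t) = s -> s = 0 \/ t = 0].

Definition monotone_triple (psi vphi : R -> R) (F : R * R -> R) : Prop :=
  nondecreasing_on_Rplus (fun x => F (psi x, vphi x)).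

(* R with the sigma-algebra of Lebesgue (not merely Borel) measurable sets, on
   which [completed_lebesgue_measure] is defined. It has to be passed explicitly
   to [measurable_fun], since Borel sets are inferred by default. *)
Definition lebesgueR : measurableType _ :=
  caratheodory_type (@wlength R idfun)^*%mu.

Definition integral_to (phi : R -> R) (a : R) : R :=
  \int[@completed_lebesgue_measure R]_(t in `[0, a]) phi t.

Definition admissible_density (phi : R -> R) : Prop :=
  [/\ forall t : R, 0 <= t -> 0 <= phi t,
      @measurable_fun _ _ lebesgueR (measurableTypeR R) Rplus phi,
      forall K : set R, compact K -> K `<=` Rplus ->
        (@completed_lebesgue_measure R).-integrable K (EFin \o phi) &
      forall eps : R, 0 < eps -> 0 < integral_to phi eps].

Definition gauge_function (gamma : R -> R) : Prop :=
  [/\ forall t : R, 0 < t -> 0 < gamma t,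
      forall s t : R, 0 < s -> s <= t -> gamma s <= gamma t,
      forall t : R, 0 < t -> gamma t < t &
      gamma 0 = 0].

End control_functions.

(* Main.v *)
(** Two points of coincidence w = Sx = Tx and z = Sy = Ty have m2 x y = |w - z|.
    If d = |w - z| > 0 and I is the integral of phi from 0 to d, then contractivity,
    monotonicity of the triple and gamma d < d give
    psi I <= F (psi I, vphi I) <= psi I, hence psi I = 0 or vphi I = 0, which
    contradicts I > 0. So PC is a singleton, of diameter 0, and the
    JH condition forces w = x. *)
Require Import Defs.
From mathcomp Require Import all_boot all_order all_algebra.
From mathcomp Require Import all_classical all_reals all_analysis.
Import Order.TTheory GRing.Theory Num.Theory.
Import numFieldNormedType.Exports.
Local Open Scope classical_set_scope.
Local Open Scope ring_scope.

Lemma integral_to_ge0 (R : realType) (phi : R -> R) (a : R) :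
  admissible_density phi -> 0 <= integral_to phi a.
Proof.
move=> [phi_ge0 _ _ _]; apply: Rintegral_ge0 => t /=.
by rewrite in_itv /= => /andP[t_ge0 _]; exact: phi_ge0.
Qed.

(** The integrand is nonnegative on [[0, b]], which contains [[0, a]]. Real values are compared
    through [fine], which is monotone only at finite values, so summability on compact sets is
    applied to both segments. *)
Lemma integral_to_le (R : realType) (phi : R -> R) (a b : R) :
  admissible_density phi -> a <= b -> integral_to phi a <= integral_to phi b.
Proof.
move=> [phi_ge0 _ phi_int _] ab.
have phi_int0 c : (@completed_lebesgue_measure R).-integrable `[0, c] (EFin \o phi).
  apply: phi_int; first exact: segment_compact.
  by move=> t /=; rewrite !in_itv /= andbT => /andP[].
(* Segments are Borel, hence Carathéodory measurable. *)
have measI c : @measurable _ (@lebesgueR R) `[0, c].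
  exact/sub_caratheodory.
rewrite /integral_to /Rintegral; apply: fine_le.
- exact: integrable_fin_num (phi_int0 a).
- exact: integrable_fin_num (phi_int0 b).
apply: ge0_subset_integral => //.
- exact: measurable_int (phi_int0 b).
- by move=> t /=; rewrite in_itv /= lee_fin => /andP[t_ge0 _]; exact: phi_ge0.
- by move=> t /=; rewrite !in_itv /= => /andP[-> /le_trans]; apply.
Qed.

(** The two terms comparing [S] with [T] at one point vanish, and the half-sum averages two copies
    of the same distance. *)
Lemma m2_coincidence (R : realType) (X : normedModType R) (S T : X -> X)
    (x y : X) :
  S x = T x -> S y = T y -> m2 S T x y = `|T x - T y|.
Proof.
move=> Sx Sy; rewrite /m2 Sx Sy !subrr normr0 (distrC (T y)).
rewrite -[X in _^-1 * X]mulr2n -[X in _^-1 * X]mulr_natl mulKf ?pnatr_eq0//.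
by rewrite (max_r (normr_ge0 _)) (max_r (normr_ge0 _)) maxxx.
Qed.

Lemma diameter1 (R : realType) (X : normedModType R) (w : X) :
  diameter [set w] = 0%E.
Proof.
rewrite /diameter.
have -> : [set `|x - y|%:E | x in [set w] & y in [set w]] = [set 0%E].
  apply/seteqP; split=> [e [_ -> [_ -> <-]]|e ->] /=; first by rewrite subrr normr0.
  by exists w => //; exists w => //; rewrite subrr normr0.
exact: ereal_sup1.
Qed.

Theorem theorem3p4 (R : realType) (X : normedModType R) (M : set X)
    (S T : X -> X) (phi gamma psi vphi : R -> R) (F : R * R -> R) (n0 : nat)
    (M_nonempty : M !=set0)
    (S_self : set_fun M M S) (T_self : set_fun M M T)
    (phi_adm : admissible_density phi)
    (gamma_gauge : gauge_function gamma)
    (ST_JH : generalized_JH_operator_pair M S T n0)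
    (psi_alt : altering_distance psi)
    (vphi_ultra : ultra_altering_distance vphi)
    (F_class : C_class F)
    (triple_mono : monotone_triple psi vphi F)
    (contractive : forall x y, M x -> M y ->
       psi (integral_to phi `|T x - T y|) <=
       F (psi (integral_to phi (gamma (m2 S T x y))),
          vphi (integral_to phi (gamma (m2 S T x y))))) :
  Fix M S `&` Fix M T !=set0.
Proof.
have [n0_gt0 [x [w [Mx PCw wS wT wx]]]] := ST_JH.
have coincidence_unique y : M y -> S y = T y -> T y = w.
  move=> My Sy; apply/eqP; rewrite wT -subr_eq0 -normr_eq0.
  apply: contraT => d_neq0.
  have d_gt0 : 0 < `|T y - T x| by rewrite lt0r d_neq0 normr_ge0.
  have [_ _ gamma_lt _] := gamma_gauge.
  have [psi_ge0 _ _ psi_eq0] := psi_alt.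
  have [vphi_ge0 _ _ vphi_gt0] := vphi_ultra.
  have [_ F_le F_eq] := F_class.
  have [_ _ _ phi_pos] := phi_adm.
  have := contractive y x My Mx.
  rewrite m2_coincidence -?wS//; set d := `|_| in d_gt0 *.
  set I := integral_to phi d => psiI.
  have I_gt0 : 0 < I by exact: phi_pos.
  have psiI_ge0 : 0 <= psi I := psi_ge0 _ (ltW I_gt0).
  have vphiI_ge0 : 0 <= vphi I := vphi_ge0 _ (ltW I_gt0).
  (* One inequality is the C-class bound. For the other, contractivity bounds [psi I] by the value
     of [F] at the integral up to [gamma d], and monotonicity of the triple raises that limit to
     [d]. *)
  have FI : F (psi I, vphi I) = psi I.
    apply/eqP; rewrite eq_le F_le//=; apply: (le_trans psiI).
    apply: triple_mono; first exact: integral_to_ge0.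
    by apply: integral_to_le => //; apply/ltW/gamma_lt.
  have [/(psi_eq0 _ (ltW I_gt0)) I0|vphiI0] := F_eq _ _ psiI_ge0 vphiI_ge0 FI.
    by move: I_gt0; rewrite I0 ltxx.
  by move: (vphi_gt0 _ I_gt0); rewrite vphiI0 ltxx.
have PC1 : PC M S T = [set w].
  apply/seteqP; split=> [z [_ [y My [zS zT]]]|z ->//] /=.
  by rewrite zT; apply: coincidence_unique => //; rewrite -zS.
have xw : w = x.
  apply/eqP; rewrite -subr_eq0 -normr_le0 -lee_fin.
  (* A positive order matters here: a positive power of the zero diameter is 0, whereas order 0
     would give the bound 1. *)
  by case: n0 n0_gt0 wx {ST_JH} => [|n] // _; rewrite PC1 diameter1 expeS mul0e.
by exists x; split; split=> //; rewrite -?wS -?wT.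
Qed.
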